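(* Let $n,N,l$ be positive integers, let $A_1,\ldots,A_N,B_1,\ldots,B_N\in\mathbb{R}^{n\times n}$ be (entrywise) nonnegative matrices, and let $f:\mathbb{R}^n\to\mathbb{R}^n$ be an admissible diagonal nonlinearity. Assume that there exist numbers $\mu>0$, $\lambda>0$ and vectors $d^{(1)}\gg 0,\ldots,d^{(N)}\gg 0$, $\theta\gg 0$ in $\mathbb{R}^n$ such that $$A_s^Td^{(r)}+B_m^Td^{(j)}\le\mu d^{(s)},\qquad s,r,m,j=1,\ldots,N,$$ $$(A_s+B_s)\theta\le\lambda\theta,\qquad s=1,\ldots,N,$$ $$\lambda\mu<1.$$ Then there exists a switched diagonal Lyapunov--Krasovskii functional of the form $$\widetilde V(k,x^{(k)})=x^T(k)P^{(\sigma(k))}x(k)+f^T(x(k-1))Q_1f(x(k-1))+\ldots+f^T(x(k-l))Q_lf(x(k-l)),$$ with $P^{(1)},\ldots,P^{(N)},Q_1,\ldots,Q_l$ positive definite diagonal matrices, for the switched system $$x(k+1)=A_{\sigma(k)}f(x(k))+B_{\sigma(k)}f(x(k-l)).$$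
   Context: Vector inequalities are componentwise: $v\le w$ means $v_i\le w_i$ for all $i$, and $v\gg 0$ means $v_i>0$ for all $i$. An admissible diagonal nonlinearity is a continuous map $f:\mathbb{R}^n\to\mathbb{R}^n$ of the form $f(x)=(f_1(x_1),\ldots,f_n(x_n))^T$ such that for each $i$: $x_if_i(x_i)>0$ for all $x_i\ne 0$, and $|f_i(x_i)|\le|x_i|$ for all $x_i$. The switching signal $\sigma$ maps the nonnegative integers to $\{1,\ldots,N\}$ and is arbitrary. Write $x^{(k)}=(x^T(k),x^T(k-1),\ldots,x^T(k-l))^T\in\mathbb{R}^{(l+1)n}$. $\widetilde V$ is a switched diagonal Lyapunov--Krasovskii functional for the switched system if its difference $\widetilde V(k+1,x^{(k+1)})-\widetilde V(k,x^{(k)})$ along trajectories of the switched system is negative, for every switching signal $\sigma$, every $k\ge 0$ and every $x^{(k)}\ne 0$; the matrices $P^{(s)},Q_m$ do not depend on $\sigma$. *)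

(* Defs.v *)
From mathcomp Require Import all_boot all_order all_algebra.
From mathcomp Require Import all_classical all_reals all_analysis.
Set Implicit Arguments.
Unset Strict Implicit.
Unset Printing Implicit Defensive.
Import Order.TTheory GRing.Theory Num.Theory.
Import numFieldNormedType.Exports.
Local Open Scope ring_scope.

Section Defs.
Variables (R : realType) (n : nat).

Definition nonneg_mx (A : 'M[R]_n) : Prop := forall i j, 0 <= A i j.

Definition vle (v w : 'cV[R]_n) : Prop := forall i, v i 0 <= w i 0.

Definition vpos (v : 'cV[R]_n) : Prop := forall i, 0 < v i 0.

Definition admissible (f : 'cV[R]_n -> 'cV[R]_n) : Prop :=
  continuous f /\
  exists phi : 'I_n -> R -> R,
    [/\ forall x i, f x i 0 = phi i (x i 0),
        forall i t, t != 0 -> 0 < t * phi i t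
      & forall i t, `|phi i t| <= `|t| ].

Definition quad (M : 'M[R]_n) (v : 'cV[R]_n) : R := (v^T *m M *m v) 0 0.

Definition posdef (M : 'M[R]_n) : Prop :=
  M^T = M /\ forall v : 'cV[R]_n, v != 0 -> 0 < quad M v.

Definition posdef_diag (M : 'M[R]_n) : Prop := is_diag_mx M /\ posdef M.

Variables (N l : nat).

(* R^((l+1)n), seen as l+1 stacked blocks of size n *)
Definition state : Type := 'cV[R]_(\sum_(j < l.+1) n).

(* x^(k) = (x(k)^T, x(k-1)^T, ..., x(k-l)^T)^T; integer times, so that the
   initial data x(-l), ..., x(0) are values of x *)
Definition history (x : int -> 'cV[R]_n) (k : nat) : state :=
  \mxcol_(j < l.+1) x (k%:Z - j%:Z).

Definition past (X : state) (j : 'I_l.+1) : 'cV[R]_n := submxcol X j.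

Definition trajectory_from (A B : 'I_N -> 'M[R]_n) (f : 'cV[R]_n -> 'cV[R]_n)
    (sigma : nat -> 'I_N) (k0 : nat) (x : int -> 'cV[R]_n) : Prop :=
  forall k : nat, (k0 <= k)%N ->
    x (k.+1)%:Z = A (sigma k) *m f (x k%:Z) + B (sigma k) *m f (x (k%:Z - l%:Z)).

(* A functional depends on k through the switching signal, hence the first
   argument. The starting time k0 is arbitrary (and no equation is imposed before
   k0), so that at each time k every vector of R^((l+1)n) occurs as some x^(k). *)
Definition switched_LK_functional (A B : 'I_N -> 'M[R]_n)
    (f : 'cV[R]_n -> 'cV[R]_n) (V : (nat -> 'I_N) -> nat -> state -> R) : Prop :=
  forall (sigma : nat -> 'I_N) (k0 : nat) (x : int -> 'cV[R]_n),
    trajectory_from A B f sigma k0 x ->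
    forall k : nat, (k0 <= k)%N -> history x k != 0 ->
      V sigma k.+1 (history x k.+1) - V sigma k (history x k) < 0.

(* Q is indexed from 0: the matrix Q_m of the formula is Q at index m - 1, which
   goes with block m = lift ord0 (m - 1) of the state. *)
Definition Vtilde (f : 'cV[R]_n -> 'cV[R]_n) (P : 'I_N -> 'M[R]_n)
    (Q : 'I_l -> 'M[R]_n) (sigma : nat -> 'I_N) (k : nat) (X : state) : R :=
  quad (P (sigma k)) (past X ord0)
  + \sum_(m < l) quad (Q m) (f (past X (lift ord0 m))).

End Defs.

(* Main.v *)
Require Import Defs.
From mathcomp Require Import all_boot all_order all_algebra.
From mathcomp Require Import all_classical all_reals all_analysis.
From mathcomp Require Import ring lra.
Import Order.TTheory GRing.Theory Num.Theory.
Local Open Scope ring_scope.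
Set Implicit Arguments.
Unset Strict Implicit.
Unset Printing Implicit Defensive.

(** Both hypotheses are used in the weights 1 / theta_i: take
      P^(s) = diag (d^(s)_i / theta_i),
      Q_m   = diag ((b_i + (l + 1 - m) h_i) / theta_i),   m = 1, ..., l,
    with b, h still to be chosen, h >> 0.

    Growth of the first term. Write s = sigma(k), r = sigma(k+1), y = f(x(k)) and
    z = f(x(k-l)). A weighted Cauchy-Schwarz inequality, applied to each row of
    A_s y + B_s z with weights theta, and (A_s + B_s) theta <= lambda theta give
      x(k+1)^T P^(r) x(k+1)
        <= sum_i (lambda (A_s^T d^(r))_i y_i^2 + lambda (B_s^T d^(r))_i z_i^2) / theta_i
    ([diag_energy_le]). The matrices have moved from the state to the vectors d,
    where the other hypothesis controls them.

    Choice of b and h. Since lambda mu < 1, multiplying the hypothesis on d by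
    lambda gives, in every coordinate i,
      lambda (B_m^T d^(j))_i < d^(s)_i - lambda (A_s^T d^(r))_i
    for all s, r, m, j. The two sides depend on separate indices, (m, j) and (s, r),
    so one number b_i separates all left sides from all right sides, leaving a gap
    of (l + 1) h_i ([finite_separation]). This is why Q can be independent of sigma.

    Balance. The coefficients of Q decrease by the constant step h from b + l h to
    b + h, so Abel summation ([abel_summation_arith]) turns the difference of the
    delayed terms into (b + l h) y^2 - b z^2 - h (sum of the f(x(k-m))^2 for
    1 <= m <= l), divided by theta. The term - b z^2 absorbs the delayed part of
    the growth. The current part has coefficient
    lambda A_s^T d^(r) + b + l h <= d^(s) - h, and y_i^2 <= x_i(k)^2 because
    |f_i(t)| <= |t|. Altogether the difference of the functional is at most
      - sum_i (h_i / theta_i) (x_i(k)^2 + sum_(1 <= m <= l) f_i(x_i(k-m))^2),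
    which is negative as soon as some block of the history is nonzero, because f_i
    vanishes only at 0. *)

Lemma quad_diag_mx (R : realType) (n : nat) (p : 'rV[R]_n) (v : 'cV[R]_n) :
  quad (diag_mx p) v = \sum_i p 0 i * v i 0 ^+ 2.
Proof.
rewrite /quad mul_mx_diag mxE; apply: eq_bigr => i _.
by rewrite !mxE expr2 mulrCA mulrA.
Qed.

Lemma posdef_diag_diag_mx (R : realType) (n : nat) (p : 'rV[R]_n) :
  (forall i, 0 < p 0 i) -> posdef_diag (diag_mx p).
Proof.
move=> p_gt0; split; first exact: diag_mx_is_diag.
split=> [|v v_neq0]; first exact: tr_diag_mx.
have pv_ge0 i : 0 <= p 0 i * v i 0 ^+ 2 by rewrite mulr_ge0 ?sqr_ge0// ltW.
have /cV0Pn[i vi_neq0] := v_neq0.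
rewrite quad_diag_mx (bigD1 i)//=; apply: ltr_wpDr; first exact: sumr_ge0.
by rewrite mulr_gt0// exprn_even_gt0.
Qed.

Lemma past_history (R : realType) (n l : nat) (x : int -> 'cV[R]_n) (k : nat)
    (j : 'I_l.+1) :
  past (history l x k) j = x (k%:Z - j%:Z).
Proof. exact: mxcolK. Qed.

(** One step of time shifts the history by one block, so the delayed part of the
    functional at time k + 1 involves x(k), ..., x(k-l+1). *)
Lemma past_historyS (R : realType) (n l : nat) (x : int -> 'cV[R]_n) (k : nat)
    (m : 'I_l) :
  past (history l x k.+1) (lift ord0 m) = x (k%:Z - m%:Z).
Proof. by rewrite past_history /= /bump /=; congr x; rewrite -!natz; ring. Qed.

Lemma history_neq0 (R : realType) (n l : nat) (x : int -> 'cV[R]_n) (k : nat) :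
  history l x k != 0 -> exists (j : 'I_l.+1) i, x (k%:Z - j%:Z) i 0 != 0.
Proof.
apply: contra_neqP => x0; apply/eqP; rewrite -mxcol0; apply/eqP.
apply: eq_mxcol => j; apply/matrixP => i c; rewrite mxE ord1.
by apply: contra_notP x0 => /eqP ?; exists j, i.
Qed.

Lemma admissible_sqr_le (R : realType) (n : nat) (f : 'cV[R]_n -> 'cV[R]_n) :
  admissible f -> forall (v : 'cV[R]_n) i, f v i 0 ^+ 2 <= v i 0 ^+ 2.
Proof.
case=> _ [phi [fE _ phi_le]] v i; rewrite fE.
rewrite -real_normK ?num_real// -[leRHS]real_normK ?num_real//.
by rewrite ler_sqr ?nnegrE.
Qed.

Lemma admissible_neq0 (R : realType) (n : nat) (f : 'cV[R]_n -> 'cV[R]_n) :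
  admissible f -> forall (v : 'cV[R]_n) i, v i 0 != 0 -> f v i 0 != 0.
Proof.
case=> _ [phi [fE phi_gt0 _]] v i /(phi_gt0 i); rewrite fE.
by apply: contraTneq => ->; rewrite mulr0 ltxx.
Qed.

(** Only an upper bound T on the total weight is available in the application, so
    instead of the sum of squares identity one sums
    2 t y_i <= t^2 w_i + y_i^2 / w_i with coefficients c_i and takes the t that is
    optimal for T. *)
Lemma weighted_Cauchy_Schwarz (R : realFieldType) (I : finType)
    (c w y : I -> R) (T : R) :
    (forall i, 0 <= c i) -> (forall i, 0 < w i) -> 0 < T ->
    \sum_i c i * w i <= T ->
  (\sum_i c i * y i) ^+ 2 <= T * \sum_i c i * (y i ^+ 2 / w i).
Proof.
move=> c_ge0 w_gt0 T_gt0 cwT.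
set X := \sum_i c i * y i; set E := \sum_i c i * (_ / _).
set t := X / T.
have XE : X = t * T by rewrite /t divfK// gt_eqF.
have : 2 * t * X <= t ^+ 2 * (\sum_i c i * w i) + E.
  rewrite !mulr_sumr -big_split/=; apply: ler_sum => i _.
  rewrite -subr_ge0.
  suff -> : t ^+ 2 * (c i * w i) + c i * (y i ^+ 2 / w i) - 2 * t * (c i * y i)
      = c i * ((t * w i - y i) ^+ 2 / w i).
    by rewrite mulr_ge0// divr_ge0 ?sqr_ge0// ltW.
  by field; rewrite gt_eqF.
have := ler_wpM2l (sqr_ge0 t) cwT.
move: XE; clearbody t X E; move: (\sum_i _) => S -> h1 h2.
have tTE : t ^+ 2 * T <= E by lra.
have -> : (t * T) ^+ 2 = T * (t ^+ 2 * T) by ring.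
by rewrite ler_wpM2l// ltW.
Qed.

(** Row i contributes at most lambda theta_i times its weighted energy; the factor
    theta_i cancels the denominator of d_i / theta_i, and exchanging the two sums
    makes the transposed matrices act on d. *)
Lemma diag_energy_le (R : realType) (n : nat) (A B : 'M[R]_n)
    (theta d y z : 'cV[R]_n) (lambda : R) :
    nonneg_mx A -> nonneg_mx B -> vpos theta -> vpos d -> 0 < lambda ->
    vle ((A + B) *m theta) (lambda *: theta) ->
  \sum_i d i 0 / theta i 0 * (A *m y + B *m z) i 0 ^+ 2 <=
  \sum_i lambda * ((A^T *m d) i 0 * y i 0 ^+ 2 + (B^T *m d) i 0 * z i 0 ^+ 2)
         / theta i 0.
Proof.
move=> A_ge0 B_ge0 theta_gt0 d_gt0 lambda_gt0 ABtheta.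
pose S i := \sum_j (A i j * (y j 0 ^+ 2 / theta j 0)
                    + B i j * (z j 0 ^+ 2 / theta j 0)).
have row_le i : (A *m y + B *m z) i 0 ^+ 2 <= lambda * theta i 0 * S i.
  (* the rows of A and B side by side, as one family of 2n coefficients *)
  pose c (u : 'I_n + 'I_n) := match u with inl j => A i j | inr j => B i j end.
  pose w (u : 'I_n + 'I_n) :=
    match u with inl j => theta j 0 | inr j => theta j 0 end.
  pose v (u : 'I_n + 'I_n) := match u with inl j => y j 0 | inr j => z j 0 end.
  have := @weighted_Cauchy_Schwarz R _ c w v (lambda * theta i 0).
  rewrite !big_sumType/= /S big_split/= !mxE; apply.
  - by case=> j; [exact: A_ge0 | exact: B_ge0].
  - by case=> j; exact: theta_gt0.
  - by rewrite mulr_gt0.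
  - have := ABtheta i; rewrite !mxE -big_split/=; apply: le_trans.
    by rewrite le_eqVlt; apply/orP; left; apply/eqP/eq_bigr => j _; rewrite mxE mulrDl.
have E1 : \sum_i d i 0 / theta i 0 * (A *m y + B *m z) i 0 ^+ 2
    <= \sum_i lambda * d i 0 * S i.
  apply: ler_sum => i _.
  have dt_ge0 : 0 <= d i 0 / theta i 0 by rewrite divr_ge0// ltW.
  apply: le_trans (ler_wpM2l dt_ge0 (row_le i)) _.
  rewrite le_eqVlt; apply/orP; left; apply/eqP.
  by field; rewrite gt_eqF.
apply: le_trans E1 _; rewrite le_eqVlt; apply/orP; left; apply/eqP.
under eq_bigr do rewrite mulr_sumr.
rewrite exchange_big/=; apply: eq_bigr => j _.
rewrite !mxE !mulr_suml -big_split/= mulr_sumr mulr_suml.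
by apply: eq_bigr => i _; rewrite !mxE; field; rewrite gt_eqF.
Qed.

(** Abel summation for the coefficients b + h l, ..., b + h, which decrease with
    constant step h; the step is what leaves a strictly negative multiple of every
    delayed value. *)
Lemma abel_summation_arith (R : comNzRingType) (b h : R) (l : nat) (u : nat -> R) :
  \sum_(m < l) (b + h * (l - m)%:R) * (u m - u m.+1) =
  (b + h * l%:R) * u 0%N - b * u l - h * \sum_(m < l) u m.+1.
Proof.
elim: l => [|l IHl]; first by rewrite !big_ord0; ring.
rewrite !big_ord_recr/= subSnn.
have step (m : 'I_l) : (b + h * (l.+1 - m)%:R) * (u m - u m.+1) =
    (b + h * (l - m)%:R) * (u m - u m.+1) + h * (u m - u m.+1).
  by rewrite subSn ?(ltnW (ltn_ord m))// mulrS; ring.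
rewrite (eq_bigr _ (fun m _ => step m)).
rewrite big_split/= IHl -mulr_sumr.
have -> : \sum_(m < l) (u m - u m.+1) = u 0%N - u l.
  rewrite -(big_mkord xpredT (fun m => u m - u m.+1)).
  by rewrite (@telescope_sumr_eq _ _ _ (fun m => - u m))// => *; ring.
rewrite -[l.+1]addn1 natrD; ring.
Qed.

(** As u and v have independent indices, max u < min v, and l + 1 equal steps fit in
    between. Base and step form one pair so that a single application of choice
    yields both as functions of the coordinate. *)
Lemma finite_separation (R : realFieldType) (I J : finType) (i0 : I) (j0 : J)
    (u : I -> R) (v : J -> R) (l : nat) :
    (forall i j, u i < v j) ->
  exists bh : R * R, [/\ 0 < bh.2, forall i, u i <= bh.1
    & forall j, bh.1 + bh.2 * l.+1%:R <= v j].
Proof.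
move=> uv.
case: (@arg_maxP _ R I i0 xpredT u isT) => i _ ui.
case: (@arg_minP _ R J j0 xpredT v isT) => j _ vj.
exists (u i, (v j - u i) / l.+1%:R); split=> /=.
- by rewrite divr_gt0 ?subr_gt0.
- by move=> i'; exact: ui.
- by move=> j'; rewrite divfK ?pnatr_eq0// addrC subrK; exact: vj.
Qed.

Lemma Vtilde_diag_mx (R : realType) (n N l : nat) (f : 'cV[R]_n -> 'cV[R]_n)
    (p : 'I_N -> 'rV[R]_n) (q : 'I_l -> 'rV[R]_n) (sigma : nat -> 'I_N) (k : nat)
    (X : state R n l) :
  Vtilde f (fun s => diag_mx (p s)) (fun m => diag_mx (q m)) sigma k X =
  \sum_i p (sigma k) 0 i * past X ord0 i 0 ^+ 2
  + \sum_i \sum_m q m 0 i * f (past X (lift ord0 m)) i 0 ^+ 2.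
Proof.
rewrite /Vtilde quad_diag_mx; congr (_ + _).
by rewrite exchange_big/=; apply: eq_bigr => m _; rewrite quad_diag_mx.
Qed.

Theorem theorem5p1 (R : realType) (n N l : nat)
    (n_gt0 : (0 < n)%N) (N_gt0 : (0 < N)%N) (l_gt0 : (0 < l)%N)
    (A B : 'I_N -> 'M[R]_n)
    (A_ge0 : forall s, nonneg_mx (A s)) (B_ge0 : forall s, nonneg_mx (B s))
    (f : 'cV[R]_n -> 'cV[R]_n) (f_adm : admissible f)
    (hyp : exists (mu lambda : R) (d : 'I_N -> 'cV[R]_n) (theta : 'cV[R]_n),
      [/\ 0 < mu /\ 0 < lambda,
          (forall s, vpos (d s)) /\ vpos theta,
          forall s r m j : 'I_N,
            vle ((A s)^T *m d r + (B m)^T *m d j) (mu *: d s),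
          forall s : 'I_N, vle ((A s + B s) *m theta) (lambda *: theta)
        & lambda * mu < 1]) :
  exists (P : 'I_N -> 'M[R]_n) (Q : 'I_l -> 'M[R]_n),
    [/\ forall s, posdef_diag (P s),
        forall m, posdef_diag (Q m)
      & switched_LK_functional A B f (Vtilde f P Q)].
Proof.
case: hyp => mu [lambda [d [theta [[mu_gt0 lambda_gt0] [d_gt0 theta_gt0]]]]].
move=> dAB thetaAB lambdamu.
pose s0 := Ordinal N_gt0.
(* the two sides separated by the gap, indexed by pairs of modes *)
pose u i (p : 'I_N * 'I_N) := lambda * ((B p.1)^T *m d p.2) i 0.
pose v i (p : 'I_N * 'I_N) := d p.1 i 0 - lambda * ((A p.1)^T *m d p.2) i 0.
have trM_ge0 (C : 'M[R]_n) e i : nonneg_mx C -> vpos e -> 0 <= (C^T *m e) i 0.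
  move=> C_ge0 e_gt0; rewrite mxE sumr_ge0// => j _.
  by rewrite mxE mulr_ge0// ltW.
have uv i p q : u i p < v i q.
  have := dAB q.1 q.2 p.1 p.2 i; rewrite mxE [leRHS]mxE /u /v.
  move=> /(ler_wpM2l (ltW lambda_gt0)).
  have := d_gt0 q.1 i; nra.
have /choice[bh bhP] i := finite_separation (s0, s0) (s0, s0) l (uv i).
pose b i := (bh i).1; pose h i := (bh i).2.
have h_gt0 i : 0 < h i by case: (bhP i).
have b_ge i s r : lambda * ((B s)^T *m d r) i 0 <= b i.
  by case: (bhP i) => _ /(_ (s, r)).
have bh_le i s r : b i + h i * l.+1%:R <= d s i 0 - lambda * ((A s)^T *m d r) i 0.
  by case: (bhP i) => _ _ /(_ (s, r)).
have b_ge0 i : 0 <= b i.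
  by apply: le_trans (b_ge i s0 s0); rewrite mulr_ge0 ?trM_ge0// ltW.
pose q (m : nat) i := (b i + h i * (l - m)%:R) / theta i 0.
pose P (s : 'I_N) := diag_mx (\row_i (d s i 0 / theta i 0)).
pose Q (m : 'I_l) := diag_mx (\row_i q m i).
exists P, Q; split.
- by move=> s; apply: posdef_diag_diag_mx => i; rewrite mxE divr_gt0 ?d_gt0.
- move=> m; apply: posdef_diag_diag_mx => i; rewrite mxE divr_gt0//.
  by rewrite ltr_wpDl// mulr_gt0// ltr0n subn_gt0.
move=> sigma k0 x traj k k0k x_neq0.
set s := sigma k; set r := sigma k.+1.
pose F i (m : nat) := f (x (k%:Z - m%:Z)) i 0 ^+ 2.
(* the dissipation: the functional decreases by at least the weighted sum of D *)
pose D i := x k%:Z i 0 ^+ 2 + \sum_(m < l) F i m.+1.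
have F_ge0 i m : 0 <= F i m by exact: sqr_ge0.
have D_gt0 : 0 < \sum_i h i / theta i 0 * D i.
  have [j [i xi]] := history_neq0 x_neq0.
  have D_ge0 i' : 0 <= D i' by rewrite addr_ge0 ?sqr_ge0 ?sumr_ge0.
  have hD_ge0 i' : 0 <= h i' / theta i' 0 * D i'.
    by rewrite mulr_ge0// divr_ge0// ltW.
  rewrite (bigD1 i)//= ltr_wpDr ?sumr_ge0// mulr_gt0// ?divr_gt0//.
  case: (unliftP ord0 j) xi => [m|] -> xi.
    rewrite /D ltr_wpDl ?sqr_ge0// (bigD1 m)//= ltr_wpDr ?sumr_ge0//.
    by rewrite exprn_even_gt0//= admissible_neq0.
  rewrite subr0 in xi.
  by rewrite /D ltr_wpDr ?sumr_ge0// exprn_even_gt0.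
suff: Vtilde f P Q sigma k.+1 (history l x k.+1)
      - Vtilde f P Q sigma k (history l x k) <= - \sum_i h i / theta i 0 * D i.
  by move=> /le_lt_trans; apply; rewrite oppr_lt0.
have VS : Vtilde f P Q sigma k.+1 (history l x k.+1) =
    \sum_i d r i 0 / theta i 0 * x k.+1%:Z i 0 ^+ 2 +
    \sum_i \sum_(m < l) q m i * F i m.
  rewrite Vtilde_diag_mx past_history subr0; congr (_ + _).
    by apply: eq_bigr => i _; rewrite mxE.
  by apply: eq_bigr => i _; apply: eq_bigr => m _; rewrite mxE past_historyS.
have V0 : Vtilde f P Q sigma k (history l x k) =
    \sum_i d s i 0 / theta i 0 * x k%:Z i 0 ^+ 2 +
    \sum_i \sum_(m < l) q m i * F i m.+1.
  rewrite Vtilde_diag_mx past_history subr0; congr (_ + _).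
    by apply: eq_bigr => i _; rewrite mxE.
  by apply: eq_bigr => i _; apply: eq_bigr => m _; rewrite mxE past_history.
have abel i : \sum_(m < l) q m i * F i m - \sum_(m < l) q m i * F i m.+1 =
   ((b i + h i * l%:R) * F i 0%N - b i * F i l - h i * \sum_(m < l) F i m.+1)
   / theta i 0.
  rewrite -abel_summation_arith mulr_suml -sumrB.
  by apply: eq_bigr => m _; rewrite /q; ring.
have energy := @diag_energy_le R n (A s) (B s) theta (d r) (f (x k%:Z))
  (f (x (k%:Z - l%:Z))) lambda (A_ge0 s) (B_ge0 s) theta_gt0 (d_gt0 r)
  lambda_gt0 (thetaAB s).
rewrite -traj// in energy.
rewrite VS V0 opprD addrACA -[X in _ + X]sumrB.
rewrite (eq_bigr _ (fun i _ => abel i)).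
rewrite -addrA; apply: le_trans (lerD energy (lexx _)) _.
rewrite -!sumrN -!big_split/=; apply: ler_sum => i _.
have := bh_le i s r; have := b_ge i s r.
have Fl : f (x (k%:Z - l%:Z)) i 0 ^+ 2 = F i l by [].
have F0 : f (x k%:Z) i 0 ^+ 2 = F i 0%N by rewrite /F subr0.
have F0_le : F i 0%N <= x k%:Z i 0 ^+ 2 by rewrite -F0; exact: admissible_sqr_le.
have alpha_ge0 := trM_ge0 _ _ i (A_ge0 s) (d_gt0 r).
rewrite Fl F0 /D.
set al := ((A s)^T *m d r) i 0; set be := ((B s)^T *m d r) i 0.
set S := \sum_(m < l) _; set X := x k%:Z i 0 ^+ 2.
move=> be_le al_le.
rewrite -subr_ge0.
set g := (X in 0 <= X).
have c_ge0 : 0 <= lambda * al + (b i + h i * l%:R).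
  by rewrite !addr_ge0// mulr_ge0// ltW.
(* each of the three products below has nonnegative factors: the first by the
   choice of b, the second because |f_i(t)| <= |t|, the third by the gap *)
have -> : g = ((b i - lambda * be) * F i l
     + (lambda * al + (b i + h i * l%:R)) * (X - F i 0%N)
     + (d s i 0 - lambda * al - (b i + h i * l.+1%:R)) * X) / theta i 0.
  rewrite /g -[l.+1]addn1 natrD; ring.
rewrite divr_ge0 ?(ltW (theta_gt0 i))//.
by rewrite !addr_ge0// mulr_ge0 ?subr_ge0// sqr_ge0.
Qed.
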